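(* Let $\mathcal A$ be a wheelgebra and let $\mathcal N$ be a wheelbimodule over $\mathcal A$. Then $\mathcal N$ is admissible.
   Context: Conventions. $k$ is a field of characteristic $0$; vector spaces, algebras and $\otimes$ are over $k$. $\mathbb N_0=\{0,1,2,\dots\}$, $\mathbb N=\{1,2,\dots\}$. $\mathbb S_n$ is the group of permutations of $\{1,\dots,n\}$ (product = composition of maps), and $\mathbb S_n\times\mathbb S_m\subseteq\mathbb S_{n+m}$ ($\mathbb S_n$ on the first $n$ letters, $\mathbb S_m$ on the last $m$). A diagonal $\mathbb S$-bimodule is a sequence $S=(S(n))_{n\in\mathbb N_0}$ of $k\mathbb S_n$-bimodules; morphisms are sequences of bimodule maps. Wheelspaces. For $\sigma\in\mathbb S_n$ and $1\le i\le n$, $r^n_i(\sigma)\in\mathbb S_{n-1}$ is obtained from $\sigma$ by deleting $i$ from the source and $\sigma(i)$ from the target and renumbering in the order-preserving way; $l^n_j(\sigma)=(r^n_j(\sigma^{-1}))^{-1}$. A wheelspace is a diagonal $\mathbb S$-bimodule $S$ with linear maps (contractions) ${}^n_jt_i\colon S(n)\to S(n-1)$, $n\in\mathbb N$, $1\le i,j\le n$, such that (W1) ${}^n_jt_i(\sigma v\tau)=l^n_j(\sigma)\cdot{}^{\ \ \ \ n}_{\sigma^{-1}(j)}t_{\tau(i)}(v)\cdot r^n_i(\tau)$ for $\sigma,\tau\in\mathbb S_n$; (W2) ${}^n_jt_i\circ{}^{n+1}_{\ \ \ell}t_k={}^n_{j'}t_{i'}\circ{}^{n+1}_{\ \ \ell'}t_{k'}$,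 where $(i',k')=(k-1,i)$ if $i<k$ and $(k,i+1)$ if $k\le i$, and $(j',\ell')$ is obtained from $(j,\ell)$ by the same rule. Wheelgebras and wheelbimodules. A wheelgebra is a wheelspace $\mathcal A$ with linear maps $\mu_{n,m}\colon\mathcal A(n)\otimes\mathcal A(m)\to\mathcal A(n+m)$ (written $ab$) that are morphisms of $k(\mathbb S_n\times\mathbb S_m)$-bimodules, associative, with a unit $1\in\mathcal A(0)$, and compatible with contractions: ${}^{n+m}_{\ \ \ j}t_i(ab)=({}^n_jt_i a)b$ if $i,j\le n$ and $=a({}^{\ \ m}_{j-n}t_{i-n}b)$ if $i,j>n$ ($a\in\mathcal A(n)$, $b\in\mathcal A(m)$). A wheelbimodule over $\mathcal A$ is a wheelspace $\mathcal N$ with left and right actions $(\rho_l)_{n,m}\colon\mathcal A(n)\otimes\mathcal N(m)\to\mathcal N(n+m)$ and $(\rho_r)_{m,n}\colon\mathcal N(m)\otimes\mathcal A(n)\to\mathcal N(m+n)$ that are associative and unital, commute with each other, and are equivariant and compatible with contractions in the same sense as the product. Admissibility. For every wheelgebra $\mathcal A$ the map ${}^2_2t_1\circ\mu_{1,1}$ makes $\mathcal A(1)$ an associative, not necessarily unital, algebra, denoted $\mathrm{alg}(\mathcal A)$. A wheelbimodule $\mathcal N$ over $\mathcal A$ is admissible if $\mathcal N(1)$ endowed with the maps ${}^2_2t_1\circ(\rho_l)_{1,1}\colon\mathcal A(1)\otimes\mathcal N(1)\to\mathcal N(1)$ and ${}^2_2t_1\circ(\rho_r)_{1,1}\colon\mathcal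 N(1)\otimes\mathcal A(1)\to\mathcal N(1)$ is an $\mathrm{alg}(\mathcal A)$-bimodule. *)

(* Defs.v *)
From HB Require Import structures.
From mathcomp Require Import all_boot all_order all_fingroup all_algebra.

Set Implicit Arguments.
Unset Strict Implicit.
Unset Printing Implicit Defensive.

Import GRing.Theory.
Local Open Scope ring_scope.

(* The letters 1, ..., n are represented by 'I_n, i.e. numbered from 0. *)

(* MathComp multiplies permutations in diagrammatic order. *)
Definition perm_comp n (s t : 'S_n) : 'S_n := (t * s)%g.

Section DeletePerm.
Variables (n : nat) (i : 'I_n.+1) (s : 'S_n.+1).

(* [unlift (s i)] is the order-preserving renumbering of the letters different
   from [s i]; the default value of [odflt] is never used, by [rdel_funE]. *)
Definition rdel_fun (a : 'I_n) : 'I_n := odflt a (unlift (s i) (s (lift i a))).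

Lemma rdel_funE a : lift (s i) (rdel_fun a) = s (lift i a).
Proof.
rewrite /rdel_fun; case: unliftP => [b -> //|/perm_inj /eqP].
by rewrite eq_sym (negbTE (neq_lift i a)).
Qed.

Lemma rdel_fun_inj : injective rdel_fun.
Proof.
move=> a b eq_ab; apply: (@lift_inj _ i); apply: (@perm_inj _ s).
by rewrite -!rdel_funE eq_ab.
Qed.

Definition rdel : 'S_n := perm rdel_fun_inj.

End DeletePerm.

Definition ldel n (j : 'I_n.+1) (s : 'S_n.+1) : 'S_n := ((rdel j s^-1)^-1)%g.

Section BlockPerm.
Variables (n m : nat) (s : 'S_n) (t : 'S_m).

Definition block_perm_fun (a : 'I_(n + m)) : 'I_(n + m) :=
  match split a with
  | inl i => lshift m (s i)
  | inr j => rshift n (t j)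
  end.

Lemma block_perm_fun_inj : injective block_perm_fun.
Proof.
move=> a b; rewrite /block_perm_fun.
case: (split_ordP a) => i ->; case: (split_ordP b) => j -> /eqP.
- by rewrite eq_lshift => /eqP /perm_inj ->.
- by rewrite eq_lrshift.
- by rewrite eq_rlshift.
- by rewrite eq_rshift => /eqP /perm_inj ->.
Qed.

Definition block_perm : 'S_(n + m) := perm block_perm_fun_inj.

End BlockPerm.

(* [k]-linear commuting left and right actions of 'S_n, i.e. the data of a
   bimodule over the group algebra of 'S_n; [sb_ract s v] is v s. *)
Record sbimodule (k : fieldType) := SBimodule {
  sb_car :> nat -> lmodType k;
  sb_lact : forall n, 'S_n -> {linear sb_car n -> sb_car n};
  sb_ract : forall n, 'S_n -> {linear sb_car n -> sb_car n};
  sb_lact1 : forall n (v : sb_car n), sb_lact 1%g v = v;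
  sb_lactM : forall n (s t : 'S_n) (v : sb_car n),
    sb_lact (perm_comp s t) v = sb_lact s (sb_lact t v);
  sb_ract1 : forall n (v : sb_car n), sb_ract 1%g v = v;
  sb_ractM : forall n (s t : 'S_n) (v : sb_car n),
    sb_ract (perm_comp s t) v = sb_ract t (sb_ract s v);
  sb_lractC : forall n (s t : 'S_n) (v : sb_car n),
    sb_ract t (sb_lact s v) = sb_lact s (sb_ract t v)
}.

Arguments sb_lact {k _ n} _.
Arguments sb_ract {k _ n} _.

(* (i, k) |-> (i', k'): contracting first k, then the letter numbered i among
   the remaining ones, is exchanged with contracting first k', then i'. *)
Definition inner_swap n (i : 'I_n.+1) (k : 'I_n.+2) : 'I_n.+1 :=
  inord (if (i < k)%N then k.-1 else k : nat).
Definition outer_swap n (i : 'I_n.+1) (k : 'I_n.+2) : 'I_n.+2 :=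
  inord (if (i < k)%N then i : nat else i.+1).

(* [contr j i], on degree n+1, is the contraction with left index j and right
   index i. *)
Record wheelspace (k : fieldType) := Wheelspace {
  ws_sb :> sbimodule k;
  contr : forall n, 'I_n.+1 -> 'I_n.+1 -> {linear ws_sb n.+1 -> ws_sb n};
  contr_equiv : forall n (j i : 'I_n.+1) (s t : 'S_n.+1) (v : ws_sb n.+1),
    contr j i (sb_ract t (sb_lact s v)) =
      sb_ract (rdel i t) (sb_lact (ldel j s) (contr ((s^-1)%g j) (t i) v));
  contr_swap : forall n (j i : 'I_n.+1) (l k : 'I_n.+2) (v : ws_sb n.+2),
    contr j i (contr l k v) =
      contr (inner_swap j l) (inner_swap i k)
        (contr (outer_swap j l) (outer_swap i k) v)
}.

Arguments contr {k _ n} _ _.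

(* Transport along an equality of degrees. *)
Definition wcast (k : fieldType) (X : wheelspace k) n m (e : n = m) (v : X n) :
  X m := eq_rect n (fun p => X p : Type) v m e.

(* Families of bilinear maps X(n) x Y(m) -> Z(n+m), equivariant and compatible
   with the contractions; the product of a wheelgebra and the actions on a
   wheelbimodule are all of this form. *)
Record pairing (k : fieldType) (X Y Z : wheelspace k) := Pairing {
  pair_map :> forall n m, {bilinear X n -> Y m -> Z (n + m)%N};
  pair_lact : forall n m (s : 'S_n) (t : 'S_m) (x : X n) (y : Y m),
    pair_map n m (sb_lact s x) (sb_lact t y) =
      sb_lact (block_perm s t) (pair_map n m x y);
  pair_ract : forall n m (s : 'S_n) (t : 'S_m) (x : X n) (y : Y m),
    pair_map n m (sb_ract s x) (sb_ract t y) =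
      sb_ract (block_perm s t) (pair_map n m x y);
  pair_contr_l : forall n m (j i : 'I_n.+1) (x : X n.+1) (y : Y m),
    contr (n := n + m) (lshift m j) (lshift m i) (pair_map n.+1 m x y) =
      pair_map n m (contr j i x) y;
  pair_contr_r : forall n m (j i : 'I_m.+1) (x : X n) (y : Y m.+1),
    contr (n := n + m) (cast_ord (addnS n m) (rshift n j))
        (cast_ord (addnS n m) (rshift n i))
        (wcast (addnS n m) (pair_map n m.+1 x y)) =
      pair_map n m x (contr j i y)
}.

(* u (v w) = (u v) w, for products of all four types involved. *)
Definition pairing_assoc (k : fieldType) (U V W UV VW T : wheelspace k)
    (uv : pairing U V UV) (uv_w : pairing UV W T)
    (vw : pairing V W VW) (u_vw : pairing U VW T) : Prop :=
  forall n m p (u : U n) (v : V m) (w : W p),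
    wcast (addnA n m p) (u_vw n (m + p)%N u (vw m p v w)) =
      uv_w (n + m)%N p (uv n m u v) w.

Definition pairing_lunit (k : fieldType) (U V : wheelspace k) (e : U 0)
    (uv : pairing U V V) : Prop :=
  forall n (v : V n), wcast (add0n n) (uv 0 n e v) = v.

Definition pairing_runit (k : fieldType) (U V : wheelspace k) (e : U 0)
    (vu : pairing V U V) : Prop :=
  forall n (v : V n), wcast (addn0 n) (vu n 0 v e) = v.

Record wheelgebra (k : fieldType) := Wheelgebra {
  wa_ws :> wheelspace k;
  wmul : pairing wa_ws wa_ws wa_ws;
  wone : wa_ws 0;
  wmulA : pairing_assoc wmul wmul wmul wmul;
  wmul1l : pairing_lunit wone wmul;
  wmul1r : pairing_runit wone wmul
}.

Record wheelbimodule (k : fieldType) (A : wheelgebra k) := Wheelbimodule {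
  wb_ws :> wheelspace k;
  wlmul : pairing A wb_ws wb_ws;
  wrmul : pairing wb_ws A wb_ws;
  wlmulA : pairing_assoc (wmul A) wlmul wlmul wlmul;
  wrmulA : pairing_assoc wrmul wrmul (wmul A) wrmul;
  wlrmulA : pairing_assoc wlmul wrmul wrmul wlmul;
  wlmul1 : pairing_lunit (wone A) wlmul;
  wrmul1 : pairing_runit (wone A) wrmul
}.

Record nonunital_algebra (k : fieldType) := NonunitalAlgebra {
  na_car :> lmodType k;
  na_mul : {bilinear na_car -> na_car -> na_car};
  na_mulA : associative na_mul
}.

Definition is_bimodule (k : fieldType) (B : nonunital_algebra k)
    (M : lmodType k) (l : {bilinear B -> M -> M}) (r : {bilinear M -> B -> M}) :
    Prop :=
  [/\ forall (a b : B) (x : M), l (na_mul B a b) x = l a (l b x),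
      forall (x : M) (a b : B), r x (na_mul B a b) = r (r x a) b
    & forall (a b : B) (x : M), r (l a x) b = l a (r x b)].

(* The contraction with left index 2 and right index 1 after the pairing in
   degrees (1, 1). *)
Definition contr21 (k : fieldType) (X Y Z : wheelspace k) (f : pairing X Y Z)
    (x : X 1) (y : Y 1) : Z 1 :=
  contr (n := 1) ord_max ord0 (f 1 1 x y).

Section Contr21Bilinear.
Variables (k : fieldType) (X Y Z : wheelspace k) (f : pairing X Y Z).

Lemma contr21_bilinear : bilinear_for *:%R *:%R (contr21 f).
Proof.
split=> [y a x x'|x a y y']; rewrite /contr21.
- by rewrite linearPl linearP.
- by rewrite linearPr linearP.
Qed.

HB.instance Definition _ :=
  bilinear_isBilinear.Build k (X 1) (Y 1) (Z 1) *:%R *:%R (contr21 f)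
    contr21_bilinear.

End Contr21Bilinear.

Lemma wcast_id (k : fieldType) (X : wheelspace k) n (e : n = n) (v : X n) :
  wcast e v = v.
Proof. by rewrite (eq_axiomK e). Qed.

Lemma contr21_mulA (k : fieldType) (A : wheelgebra k) :
  associative (contr21 (wmul A)).
Proof.
move=> a b c; rewrite /contr21.
have := @pair_contr_r _ _ _ _ (wmul A) 1 1 ord_max ord0 a (wmul A 1 1 b c).
rewrite wcast_id => <-.
have := @pair_contr_l _ _ _ _ (wmul A) 1 1 ord_max ord0 (wmul A 1 1 a b) c.
move=> <-; have := @wmulA k A 1 1 1 a b c; rewrite wcast_id => ->.
rewrite [RHS]contr_swap; congr (contr _ _ (contr _ _ _));
  by apply/val_inj; rewrite /= inordK.
Qed.

Definition alg (k : fieldType) (A : wheelgebra k) : nonunital_algebra k :=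
  @NonunitalAlgebra k (A 1) (contr21 (wmul A)) (@contr21_mulA k A).

Definition admissible (k : fieldType) (A : wheelgebra k)
    (N : wheelbimodule A) : Prop :=
  @is_bimodule k (alg A) (N 1) (contr21 (wlmul N)) (contr21 (wrmul N)).

(* Main.v *)
Require Import Defs.
From mathcomp Require Import all_boot all_order all_fingroup all_algebra.

(** Each bimodule axiom compares the two bracketings of a triple of degree 1
    elements, two from [A] and one from [N].  Compatibility of the pairings
    with the contractions turns either bracketing into a double contraction of
    the same triple product of degree 3: the bracketing u (v w) first contracts
    the left index 3 with the right index 2, whereas (u v) w first contracts
    the left index 2 with the right index 1; both then contract the left index
    2 with the right index 1.  The two orders remove the same two pairs of
    indices, (3, 2) and (2, 1), so they agree by the exchange rule [contr_swap].
    The position of the module element among the three factors is irrelevant, so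
    [contr21_assoc] covers the three axioms at once. *)

(** Stated for arbitrary pairings because the three factors and their partial
    products live in different wheelspaces according to the axiom; the exchange rule is only
    ever applied in the common target [T]. *)
Lemma contr21_assoc (k : fieldType) (U V W UV VW T : wheelspace k)
    (uv : pairing U V UV) (uv_w : pairing UV W T)
    (vw : pairing V W VW) (u_vw : pairing U VW T) :
    pairing_assoc uv uv_w vw u_vw ->
  forall (u : U 1) (v : V 1) (w : W 1),
    contr21 u_vw u (contr21 vw v w) = contr21 uv_w (contr21 uv u v) w.
Proof.
move=> assoc u v w; rewrite /contr21.
(* As u occupies the first position, contracting v w at (2, 1) amounts to
   contracting u (v w) at (3, 2). *)
have := @pair_contr_r _ _ _ _ u_vw 1 1 ord_max ord0 u (vw 1 1 v w).
rewrite wcast_id => <-.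
have := @pair_contr_l _ _ _ _ uv_w 1 1 ord_max ord0 (uv 1 1 u v) w.
move=> <-; have := assoc 1 1 1 u v w; rewrite wcast_id => ->.
rewrite [RHS]contr_swap; congr (contr _ _ (contr _ _ _));
  by apply/val_inj; rewrite /= inordK.
Qed.

Theorem lemma4p37 (k : fieldType) (char0 : [pchar k]%R =i pred0)
  (A : wheelgebra k) (N : wheelbimodule A) : admissible N.
Proof.
split=> [a b x|x a b|a x b].
- exact/esym/contr21_assoc/wlmulA.
- exact/contr21_assoc/wrmulA.
- exact/esym/contr21_assoc/wlrmulA.
Qed.
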